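(* Let $0\le m_2\le m_1$, where $m_2=m_2(m_1)$ may depend on $m_1$, and let $T_{m_1,m_2}$ be the random variable of the card guessing game described in the context. As $m_1\to\infty$, the limiting distribution of $T_{m_1,m_2}$, depending on the growth of $m_2$, is as follows. (1) If $m_2\ge 1$ is fixed: $T_{m_1,m_2}/m_1$ converges in distribution to a random variable $Y^{[m_2]}$ with distribution function $F(y)=1-(1-y)^{m_2}$, $0<y<1$; that is, $Y^{[m_2]}\sim\mathrm{Beta}(1,m_2)$, equivalently $Y^{[m_2]}$ is distributed as $\min\{U_1,\dots,U_{m_2}\}$ with $U_1,\dots,U_{m_2}$ mutually independent and uniform on $[0,1]$. (2) If $m_2=o(m_1)$ and $m_2\to\infty$: $m_2T_{m_1,m_2}/m_1$ converges in distribution to a random variable $Y\sim\mathrm{Exp}(1)$, i.e. with distribution function $F(y)=1-e^{-y}$, $y>0$. (3) If $m_2\sim\rho\,m_1$ with $0<\rho\le1$: $T_{m_1,m_2}$ converges in distribution to a discrete random variable $Y_\rho$ with probability mass function $$\mathbb{P}\{Y_\rho=\ell\}=\frac{\rho+\rho^{\ell}}{(1+\rho)^{\ell+1}},\qquad \ell\ge1.$$ Moreover, $Y_\rho$ is a mixture of two geometric random variables: $Y_\rho$ has the same distribution as $$I_1\cdot \mathrm{Geom}\Big(\frac{\rho}{1+\rho}\Big)+(1-I_1)\cdot\mathrm{Geom}\Big(\frac{1}{1+\rho}\Big),\qquad I_1\sim\mathrm{Bernoulli}\Big(\frac1{1+\rho}\Big),$$ where $I_1$ is independent of the geometric random vari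ables.
   Context: Card guessing game: a deck consists of $m_1$ cards of one colour (red) and $m_2$ cards of another colour (black), with integers $0\le m_2\le m_1$, in uniformly random order. The cards are drawn from the top one at a time and discarded until the deck is empty. Before each draw the guesser knows the numbers of remaining red and black cards and guesses the colour of the next card so as to maximize the probability of being correct: the colour with strictly more remaining cards is guessed; if both colours have equally many remaining cards, either colour may be guessed (without information on the order of the remaining cards), with success probability $1/2$. $T_{m_1,m_2}$ is the number of correct guesses made with success probability $p=1$ (i.e. when only one colour remains). $\mathrm{Geom}(p)$ denotes the geometric distribution with probability mass function $p(1-p)^{\ell-1}$, $\ell\ge1$. *)

(* Defs.v *)
From HB Require Import structures.
From mathcomp Require Import all_boot all_order all_algebra all_fingroup.
From mathcomp Require Import all_classical all_reals all_analysis.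

Set Implicit Arguments.
Unset Strict Implicit.
Unset Printing Implicit Defensive.

Import Order.TTheory GRing.Theory Num.Theory.
Import numFieldNormedType.Exports.

Local Open Scope classical_set_scope.
Local Open Scope ring_scope.

HB.instance Definition _ (n : nat) :=
  isPointed.Build (perm_type 'I_n) (1%g : 'S_n).
HB.instance Definition _ (n : nat) :=
  @isMeasurable.Build default_measure_display (perm_type 'I_n) discrete_measurable
    discrete_measurable0 discrete_measurableC discrete_measurableU.

(* The uniform distribution on the orders of n distinguishable cards. The
   Dirac mass is the fallback required by mnormalize; it is never used, since
   the counting measure of 'S_n is neither 0 nor infinite. *)
Definition shuffle {R : realType} (n : nat) : probability 'S_n R :=
  mnormalize (@counting 'S_n R) (@dirac _ 'S_n 1%g R).

Definition colour := bool.
Definition red : colour := true.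
Definition black : colour := false.

(* Cards 0, ..., m1 - 1 are red and cards m1, ..., m1 + m2 - 1 are black;
   s i is the card at position i from the top. *)
Definition deck (m1 m2 : nat) (s : 'S_(m1 + m2)) : seq colour :=
  [seq (if (s i < m1)%N then red else black) | i <- enum 'I_(m1 + m2)].

(* A tie-breaking rule is applied when r red and r black cards remain; it may
   depend on the colours drawn so far and on r, hence also on m1 and m2. *)
Definition tie_rule := seq colour -> nat -> colour.

Definition guess (tie : tie_rule) (drawn : seq colour) (r b : nat) : colour :=
  if (b < r)%N then red else if (r < b)%N then black else tie drawn r.

Definition success_prob (g : colour) (r b : nat) : rat :=
  (if g == red then r else b)%:R / (r + b)%:R.

(* Number of correct guesses made with success probability 1 while the cards
   of [rest] are drawn, those of [drawn] having been drawn before. *)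
Fixpoint sure_hits (tie : tie_rule) (drawn rest : seq colour) : nat :=
  if rest is c :: rest' then
    let r := count_mem red rest in
    let b := count_mem black rest in
    let g := guess tie drawn r b in
    (((g == c) && (success_prob g r b == 1%R)) +
      sure_hits tie (rcons drawn c) rest')%N
  else 0%N.

Definition T_game (tie : tie_rule) (m1 m2 : nat) (s : 'S_(m1 + m2)) : nat :=
  sure_hits tie [::] (deck s).

Section game_rv.
Context {R : realType} (tie : tie_rule) (m1 m2 : nat).

Definition scaled_T (a : R) (s : 'S_(m1 + m2)) : R := a * (T_game tie s)%:R.

Lemma measurable_scaled_T a :
  measurable_fun [set: 'S_(m1 + m2)] (scaled_T a).
Proof. by []. Qed.

HB.instance Definition _ a :=
  isMeasurableFun.Build _ _ _ _ (scaled_T a) (measurable_scaled_T a).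

(* the random variable a * T_{m1,m2} *)
Definition T_rv (a : R) : {RV (@shuffle R (m1 + m2)) >-> R} := scaled_T a.

End game_rv.

(* The X n may live on different probability spaces. *)
Definition cvg_in_distribution {R : realType} (d : nat -> measure_display)
    (Om : forall n, measurableType (d n)) (P : forall n, probability (Om n) R)
    (X : forall n, {RV (P n) >-> R})
    (nu : probability (measurableTypeR R) R) : Prop :=
  forall y : R, {for y, continuous (fun x : R => nu `]-oo, x]%classic)} ->
    cdf (X n) y @[n --> \oo] --> nu `]-oo, y]%classic.

(* exponential_prob rate is a probability only when 0 < rate, a side condition
   that canonical-structure inference does not fill in. *)
Definition exponential_law {R : realType} (rate : R) (rate_gt0 : 0 < rate) :
    probability (measurableTypeR R) R :=
  exponential_distribution_exponential_prob__canonical__probability_measure_Probability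
    rate_gt0.

Section families.
Context {d} {Om : measurableType d} {R : realType} (P : probability Om R).

Definition mutually_independent (k : nat) (X : 'I_k -> {RV P >-> R}) : Prop :=
  forall (J : {set 'I_k}) (B : 'I_k -> set R), (forall i, measurable (B i)) ->
    P (\bigcap_(i in [set` J]) X i @^-1` B i) =
    (\prod_(i in J) P (X i @^-1` B i))%E.

Definition independent2 (d1 d2 : measure_display) (T1 : measurableType d1)
    (T2 : measurableType d2) (X : {RV P >-> T1}) (Y : {RV P >-> T2}) : Prop :=
  forall (A : set T1) (B : set T2), measurable A -> measurable B ->
    P (X @^-1` A `&` Y @^-1` B) = (P (X @^-1` A) * P (Y @^-1` B))%E.

Definition has_law (d1 : measure_display) (T1 : measurableType d1)
    (X : Om -> T1) (nu : set T1 -> \bar R) : Prop :=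
  forall A : set T1, measurable A -> P (X @^-1` A) = nu A.

Definition geometric_rv (p : R) (X : {RV P >-> R}) : Prop :=
  forall l : nat, (1 <= l)%N -> pmf X l%:R = p * (1 - p) ^+ l.-1.

End families.

(* Main.v *)
Require Import Defs.
From HB Require Import structures.
From mathcomp Require Import all_boot all_order all_algebra all_fingroup.
From mathcomp Require Import all_classical all_reals all_analysis.
From mathcomp Require Import unstable measurable_realfun zify ring lra.

Set Implicit Arguments.
Unset Strict Implicit.
Unset Printing Implicit Defensive.

Import Order.TTheory GRing.Theory Num.Theory.
Import numFieldNormedType.Exports.

Local Open Scope classical_set_scope.
Local Open Scope ring_scope.

(** A draw is a sure hit exactly when the remaining cards, the next one
included, all have the same colour: for r, b > 0 the success probability is
less than 1 whatever is guessed, and for min(r, b) = 0 < max(r, b) the guess is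
forced and correct.  Hence T is the length of the last run of the deck, ties
never matter ([sure_hitsE]), and T >= l, for l >= 1, says that the last l cards
are all red or all black.  By the symmetry of the uniform distribution
([card_perm_ffact]) this has probability
      (m1)_l / (m1 + m2)_l + (m2)_l / (m1 + m2)_l,
with (m)_l the falling factorial; it is called [run_tail] below, and the
distribution function of a multiple of T is 1 minus one of its values
([cdf_T_rv]).  What is left is the behaviour of these quotients for
m1 -> infinity.

- If m2 = k is fixed and l ~ y m1, the double count
  (m1)_l (m1 + k)_k = (m1 + k)_(l + k) = (m1 + k - l)_k (m1 + k)_l turns the
  quotient of two products with l factors into one with k factors, each of
  which tends to 1 - y if y < 1 ([ffact_ratio_sym], [cvg_run_tail_fixed]).  The limit
  1 - (1 - y)^k is the distribution function of Beta(1, k) ([beta1_cdf]), and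
  of the minimum of k independent uniform variables ([min_uniform_law]).

- If m2 = o(m1), m2 -> infinity and l ~ y m1 / m2, then all l factors of
  (m1)_l / (m1 + m2)_l lie between two numbers of the form 1 - m2 / m1 (1 + o(1)),
  so the quotient is squeezed between two exponentials that tend to exp(-y)
  ([cvg_ffact_ratio_exp]).

- If m2 ~ rho m1 and l is fixed, each of the l factors converges, and the tail
  tends to a^l + b^l with a = 1 / (1 + rho) and b = rho / (1 + rho) = 1 - a
  ([cvg_run_tail_rho]).  The difference of consecutive tails is
  a^l b + b^l a: this is the announced mass function, and, read as
  a (b a^(l-1)) + b (a b^(l-1)), the mixture of the two geometric laws
  ([geometric_mixture_exists], [mixture_law]).

In the first two cases the black term of the tail is at most m2 / m1 and
disappears ([cvg_minor]).  In all cases the distribution functions converge at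
every point, not only at the continuity points of the limit.  The two identities
in law are reduced to distribution functions ([cdf_unique]) and to atoms
([discrete_law_unique]). *)

(** * Counting permutations *)

Section card_perm_imset.
Local Open Scope nat_scope.
Context {T : finType} (A : {set T}).

Definition perms_into (J : {set T}) : {set {perm T}} :=
  [set s : {perm T} | [forall i in J, s i \in A]]%SET.

(** Composing with the transposition of j and k exchanges the two sets. *)
Lemma card_perm_swap (J : {set T}) (j k : T) : j \notin J -> k \notin J ->
  #|perms_into (j |: J)%SET| = #|perms_into (k |: J)%SET|.
Proof.
move=> jJ kJ.
rewrite -(card_preimset (perms_into (j |: J)%SET) (mulgI (tperm j k))).
apply: eq_card => s; rewrite !inE.
apply/'forall_implyP/'forall_implyP => sA i.
  case/setU1P => [->|iJ].
    by have := sA j (setU11 _ _); rewrite permM tpermL.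
  have := sA i (setU1r _ iJ); rewrite permM tpermD //.
    by apply: contraNneq jJ => ->.
  by apply: contraNneq kJ => ->.
rewrite permM; case/setU1P => [->|iJ].
  by rewrite tpermL; apply: sA; exact: setU11.
rewrite tpermD; first by apply: sA; exact: setU1r.
- by apply: contraNneq jJ => ->.
- by apply: contraNneq kJ => ->.
Qed.

(** Double count of the pairs (s, k) where s sends J into A, k is outside J and
s k lies in A: by [card_perm_swap] each k contributes equally, and for given s
exactly #|A| - #|J| choices of k remain. *)
Lemma card_perm_step (J : {set T}) (j : T) : j \notin J ->
  #|perms_into (j |: J)%SET| * (#|T| - #|J|) = #|perms_into J| * (#|A| - #|J|).
Proof.
move=> jJ.
have -> : #|T| - #|J| = #|(~: J)%SET| by rewrite (cardsCs (~: J)%SET) finset.setCK.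
transitivity (\sum_(k in (~: J)%SET) #|perms_into (k |: J)%SET|).
  rewrite mulnC -sum_nat_const; apply: eq_bigr => k kJ.
  by rewrite inE in kJ; rewrite (card_perm_swap jJ kJ).
transitivity (\sum_(s in perms_into J) #|(s @^-1: A :\: J)%SET|).
  under eq_bigr do rewrite -sum1_card.
  under [RHS]eq_bigr do rewrite -sum1_card.
  rewrite (exchange_big_dep (mem (perms_into J))) /=.
    apply: eq_bigr => s sJ; apply: eq_bigl => k; rewrite !inE in sJ *.
    rewrite andbC; case kJ: (k \in J) => //=; rewrite ?andbF ?andbT//.
    apply/'forall_implyP/idP => [|skA i /setU1P[->//|]]; first by apply; exact: setU11.
    by move/'forall_implyP : sJ; apply.
  move=> k s _; rewrite !inE => /'forall_implyP sA.
  by apply/'forall_implyP => i iJ; apply: sA; exact: setU1r.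
rewrite -sum_nat_const; apply: eq_bigr => s; rewrite inE => /'forall_implyP sJ.
rewrite cardsD (card_preimset _ (@perm_inj _ s)); congr (_ - #|pred_of_set _|).
by apply/finset.setIidPr/fintype.subsetP => i /sJ; rewrite inE.
Qed.

(** The probability that a uniform permutation sends J into A is
(#|A|)_#|J| / (#|T|)_#|J|.  The product form stays true when the falling factorials
vanish. *)
Lemma card_perm_ffact (J : {set T}) :
  #|perms_into J| * #|T| ^_ #|J| = (#|T|)`! * #|A| ^_ #|J|.
Proof.
elim: {J}#|J| {-2}J (erefl #|J|) => [|n IHn] J cJ.
  rewrite (cards0_eq cJ) cards0 !ffactn0 !muln1.
  rewrite -(cardsT T) -card_perm; apply: eq_card => s; rewrite !inE.
  transitivity true; first by apply/'forall_implyP => i; rewrite inE.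
  by apply/esym/fintype.subsetP => i; rewrite inE.
have [j jJ] : exists j, j \in J by apply/set0Pn; rewrite -card_gt0 cJ.
rewrite -(finset.setD1K jJ); set K := (J :\ j)%SET.
have cK : #|K| = n by apply: succn_inj; rewrite -cJ [RHS](cardsD1 j) jJ.
have jK : j \notin K by rewrite !inE eqxx.
rewrite cardsU1 jK cK add1n !ffactnSr.
have := card_perm_step jK; rewrite cK => stepE.
have := IHn K cK; rewrite cK => IH.
by rewrite mulnCA stepE [RHS]mulnA -IH mulnCA mulnA.
Qed.

End card_perm_imset.

(** * Sure hits form the final one-coloured run *)

Lemma constant_colours (s : seq colour) (x : colour) : x \in s ->
  constant s = all (pred1 red) s || all (pred1 black) s.
Proof.
case: s => //= y s _.
by case: y => /=; rewrite ?orbF; apply: eq_all => -[].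
Qed.

Lemma success_prob_eq1 (g : colour) (r b : nat) : (0 < r + b)%N ->
  (success_prob g r b == 1) = ((if g == red then r else b) == (r + b)%N).
Proof.
rewrite /success_prob => rb0.
have rb : (r + b)%N%:R != 0 :> rat by rewrite pnatr_eq0 -lt0n.
by rewrite -[X in _ == X](divff rb) (inj_eq (mulIf _)) ?invr_eq0// eqr_nat.
Qed.

(** If one colour is missing, the strict majority is the colour of all remaining
cards, so the guess is right; if both are present, neither count equals the
total. *)
Lemma sure_hit_constant (tie : tie_rule) (dr : seq colour) (c : colour) (s : seq colour) :
  let r := count_mem red (c :: s) in
  let b := count_mem black (c :: s) in
  ((guess tie dr r b == c) && (success_prob (guess tie dr r b) r b == 1%R)) =
  constant (c :: s).
Proof.
move=> r b.
have sz : (r + b)%N = size (c :: s).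
  rewrite -(count_predC (pred1 red)); congr addn.
  by apply: eq_count => -[].
have rb0 : (0 < r + b)%N by rewrite sz.
rewrite (constant_colours (mem_head c s)) !all_count -sz -/r -/b.
have rE : (r == (r + b)%N) = (b == 0%N) by rewrite -{1}[r]addn0 eqn_add2l eq_sym.
have bE : (b == (r + b)%N) = (r == 0%N) by rewrite -{1}[b]add0n eqn_add2r eq_sym.
have cP : if c == red then (0 < r)%N else (0 < b)%N.
  by rewrite /r /b; case: (c).
rewrite success_prob_eq1// rE bE /guess; case: (ltngtP b r) => [br|rb|rb].
- rewrite eqxx rE [r == 0%N]gtn_eqF ?(leq_ltn_trans _ br)// orbF.
  move: cP; case: (c); rewrite ?eqxx//= => b_gt0.
  by rewrite gtn_eqF.
- rewrite [black == red]/= bE [b == 0%N]gtn_eqF ?(leq_ltn_trans _ rb)//=.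
  move: cP; case: (c); rewrite ?eqxx//= => r_gt0.
  by rewrite gtn_eqF.
- have r0 : (0 < r)%N by move: rb0; rewrite rb addnn double_gt0.
  have -> (x : bool) : (if x then r else b) = r by rewrite rb; case: x.
  by rewrite rE rb !gtn_eqF// andbF.
Qed.

(** Suffixes of a constant sequence are constant, so the sure hits are the draws
of the longest constant suffix. *)
Lemma sure_hitsE (tie : tie_rule) (l : nat) (dr s : seq colour) : (0 < l)%N ->
  (l <= sure_hits tie dr s)%N = (l <= size s)%N && constant (drop (size s - l) s).
Proof.
move=> l0; elim: s dr => [|c s IHs] dr; first by rewrite /= leqNgt l0.
have run_size (t : seq colour) d : constant t -> sure_hits tie d t = size t.
  elim: t d => // e t IHt d cst; rewrite [sure_hits _ _ _]/= sure_hit_constant cst IHt//.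
  by case: t cst {IHt} => //= f t /andP[/eqP-> ].
rewrite [sure_hits _ _ _]/= sure_hit_constant.
have [cst|ncst] := boolP (constant (c :: s)).
  have cs : constant s by case: s cst {IHs} => //= f t /andP[/eqP-> ].
  rewrite run_size// [size (_ :: _)]/= -[X in (_ <= X)%N]/(size s).+1.
  case: leqP => //= lsz; apply/esym.
  by case/constantP: cst => // x ->; rewrite drop_nseq constant_nseq.
rewrite -[X in (_ <= X)%N]/(sure_hits _ _ _) IHs [size (_ :: _)]/=.
case: (ltngtP l (size s).+1) => [lsz|lsz|->].
- by rewrite -ltnS lsz /= subSn.
- by rewrite leqNgt (ltn_trans _ lsz)//= leqNgt lsz.
- by rewrite ltnn subnn drop0 (negbTE ncst).
Qed.

Section game_count.
Local Open Scope nat_scope.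
Context (tie : tie_rule) (m1 m2 : nat).
Local Notation n := (m1 + m2).

Lemma all_drop_deck (a : pred colour) (l : nat) (s : 'S_n) : l <= n ->
  all a (drop (n - l) (deck s)) =
  [forall i in [set i : 'I_n | n - l <= i]%SET, a (s i < m1)].
Proof.
move=> ln; rewrite /deck -map_drop all_map.
apply/allP/'forall_implyP => /= H i.
  rewrite inE => li; have := H i; rewrite /preim/=.
  have -> : (if s i < m1 then red else black) = (s i < m1) by case: ifP.
  apply.
  rewrite -(nth_ord_enum i i) -[X in nth _ _ X](subnKC li) -nth_drop.
  apply: mem_nth; rewrite size_drop size_enum_ord.
  by rewrite ltn_sub2r// (leq_ltn_trans li).
move=> /(nthP i)[j]; rewrite size_drop size_enum_ord nth_drop => jl ij.
rewrite /preim/=.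
have -> : (if s i < m1 then red else black) = (s i < m1) by case: ifP.
apply: H; rewrite inE -ij nth_enum_ord ?leq_addr//.
by rewrite -ltn_subRL.
Qed.

(** The events that the last l cards are all red and all black are disjoint
because l > 0, and each is counted by [card_perm_ffact]. *)
Lemma card_T_game_ge (l : nat) : 0 < l ->
  #|[set s : 'S_n | l <= T_game tie s]%SET| * n ^_ l = n`! * (m1 ^_ l + m2 ^_ l).
Proof.
move=> l0; have [ln|nl] := leqP l n; last first.
  rewrite ffact_small// muln0 !ffact_small ?muln0//.
    by rewrite (leq_ltn_trans _ nl)// leq_addl.
  by rewrite (leq_ltn_trans _ nl)// leq_addr.
pose J := [set i : 'I_n | n - l <= i]%SET.
have cJ : #|J| = l.
  rewrite -sum1dep_card -(big_mkord (fun i => n - l <= i) (fun=> 1)).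
  rewrite -(big_nat_widenl _ _ _ predT)// sum_nat_const_nat muln1.
  by rewrite subKn.
pose A := [set i : 'I_n | i < m1]%SET.
have cA : #|A| = m1.
  rewrite -sum1dep_card -(big_mkord (fun i => i < m1) (fun=> 1)).
  rewrite -(big_nat_widen _ _ _ predT) ?leq_addr// sum_nat_const_nat muln1.
  by rewrite subn0.
have cB : #|(~: A)%SET| = m2 by rewrite cardsCs finset.setCK cA card_ord addKn.
have := card_perm_ffact (~: A)%SET J; have := card_perm_ffact A J.
rewrite cA cB cJ card_ord => redE blackE.
rewrite mulnDr -redE -blackE -mulnDl -cardsUI; congr (_ * _).
rewrite [X in _ = _ + X](_ : _ = 0) ?addn0; last first.
  apply/eqP; rewrite cards_eq0; apply/eqP/setP => s; rewrite !inE.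
  apply/negP => /andP[/'forall_implyP sA /'forall_implyP sB].
  have /card_gt0P[j jJ] : 0 < #|J| by rewrite cJ.
  by have := sB j jJ; rewrite inE sA.
apply: eq_card => s; rewrite !inE /T_game sure_hitsE//.
have -> : size (deck s) = n by rewrite size_map size_enum_ord.
rewrite ln/=.
have [x xd] : exists x, x \in drop (n - l) (deck s).
  case E: (drop (n - l) (deck s)) => [|x t]; last by exists x; rewrite mem_head.
  move/(congr1 size) : E; rewrite size_drop size_map size_enum_ord subKn//=.
  by move=> l00; rewrite l00 in l0.
rewrite (constant_colours xd) !all_drop_deck//.
by congr (_ || _); apply: eq_forallb => i; rewrite !inE/=; case: (s i < m1).
Qed.

End game_count.

(** * The distribution function of the number of sure hits *)

Section shuffle_measure.
Context {R : realType}.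

Lemma counting_pred (T : finType) (p : pred T) :
  counting [set x | p x] = (#|p|%:R)%:E :> \bar R.
Proof.
rewrite /counting asboolT; last exact: finite_finset.
congr (_%:R)%:E; rewrite cardE; apply/perm_size/uniq_perm => //.
  exact: enum_uniq.
move=> x; rewrite mem_enum.
apply: (etrans (in_fset_set (@finite_finset _ [set x | p x]) x)).
by apply/idP/idP; rewrite inE.
Qed.

Lemma mnormalizeE d (T : measurableType d) (mu : {measure set T -> \bar R})
    (P : probability T R) (c : R) (A : set T) :
  mu setT = c%:E -> 0 < c -> mnormalize mu P A = (mu A * c^-1%:E)%E.
Proof.
by move=> muT c0; rewrite /mnormalize muT eqe gt_eqF.
Qed.

Lemma shuffle_pred (n : nat) (p : pred 'S_n) :
  @shuffle R n [set s | p s] = (#|p|%:R / n`!%:R)%:E.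
Proof.
have nT : counting [set: 'S_n] = (n`!%:R)%:E :> \bar R.
  by rewrite -card_Sn -counting_pred; congr counting; apply/seteqP.
apply: etrans (mnormalizeE _ _ nT _) _; first by rewrite ltr0n fact_gt0.
by rewrite [RHS]EFinM; congr (_ * _)%E; exact: counting_pred.
Qed.

(** The probability that the last run has length at least l, for l > 0.  For
l > m1 + m2 the division by 0 gives the correct value 0. *)
Definition run_tail (m1 m2 l : nat) : R :=
  (m1 ^_ l + m2 ^_ l)%:R / ((m1 + m2) ^_ l)%:R.

Lemma shuffle_T_game_le (tie : tie_rule) (m1 m2 t : nat) :
  @shuffle R (m1 + m2) [set s | (T_game tie s <= t)%N] =
  (1 - run_tail m1 m2 t.+1)%:E.
Proof.
set n := (m1 + m2)%N; rewrite shuffle_pred; congr EFin.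
have fn : (n`!)%:R != 0 :> R by rewrite pnatr_eq0 -lt0n fact_gt0.
pose B := [set s : 'S_n | (t < T_game tie s)%N]%SET.
have -> : #|[pred s : 'S_n | (T_game tie s <= t)%N]| = (n`! - #|B|)%N.
  rewrite -card_Sn -(cardC (mem B)) addKn; apply: eq_card => s.
  by rewrite !inE -leqNgt.
rewrite natrB; last by rewrite -card_Sn; exact: max_card.
rewrite mulrBl divff//; congr (1 - _).
rewrite /run_tail -/n; have [tn|nt] := ltnP t n.
  have ffn : (n ^_ t.+1)%:R != 0 :> R by rewrite pnatr_eq0 -lt0n ffact_gt0.
  apply/eqP; rewrite eqr_div// -!natrM mulnC [X in _ == X%:R]mulnC.
  by rewrite mulnC card_T_game_ge// mulnC.
rewrite [n ^_ _]ffact_small ?ltnS// invr0 mulr0.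
rewrite [B](_ : _ = finset.set0) ?cards0 ?mul0r//.
apply/setP => s; rewrite !inE sure_hitsE// size_map size_enum_ord -/n.
by rewrite ltnNge nt.
Qed.

(** Since T is an integer, a T <= y means T <= floor (y / a). *)
Lemma cdf_T_rv (tie : tie_rule) (m1 m2 : nat) (a y : R) : 0 < a -> 0 <= y ->
  cdf (T_rv tie m1 m2 a) y = (1 - run_tail m1 m2 (Num.truncn (y / a)).+1)%:E.
Proof.
move=> a0 y0; rewrite -(shuffle_T_game_le tie) /cdf/= /distribution /pushforward.
have ya0 : 0 <= y / a by rewrite divr_ge0// ltW.
have truncnE k : (k <= Num.truncn (y / a))%N = (k%:R <= y / a) by exact: truncn_ge_nat.
move: truncnE; set t := Num.truncn _ => truncnE.
congr (shuffle _ _); apply/seteqP; split=> s /=;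
  by rewrite in_itv/= /scaled_T mulrC -ler_pdivlMr// truncnE.
Qed.

Lemma cdf_T_rv_lt0 (tie : tie_rule) (m1 m2 : nat) (a y : R) : 0 <= a -> y < 0 ->
  cdf (T_rv tie m1 m2 a) y = 0%E.
Proof.
move=> a0 y0; rewrite /cdf/= /distribution /pushforward.
rewrite (_ : _ @^-1` _ = set0) ?measure0//.
apply/seteqP; split=> s //=; rewrite in_itv/= /scaled_T leNgt.
by rewrite (lt_le_trans y0)// mulr_ge0.
Qed.
End shuffle_measure.

(** * Laws on the line determined by their distribution function or atoms *)

Section discrete_law.
Context {R : realType}.

(** Two probability measures with the same atoms at the positive integers agree
on sets of positive integers by countable additivity; if one of them is carried
by the positive integers, so is the other. *)
Lemma discrete_law_unique (mu nu : probability (measurableTypeR R) R) :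
  (forall n : nat, mu [set n.+1%:R] = nu [set n.+1%:R]) ->
  nu (\bigcup_n [set n.+1%:R]) = 1%E ->
  forall A : set R, measurable A -> mu A = nu A.
Proof.
move=> munu nuS A mA.
set S := \bigcup_n [set n.+1%:R] in nuS *.
have mS : measurable S by exact: bigcup_measurable.
have eqS B : measurable B -> mu (B `&` S) = nu (B `&` S).
  move=> mB; rewrite setI_bigcupr.
  have mBn n : measurable (B `&` [set n.+1%:R]) by exact: measurableI.
  have tB : trivIset setT (fun n => B `&` [set n.+1%:R] : set R).
    move=> i j _ _ [x [[_ /= ->] [_ /=]]].
    by move=> /eqP; rewrite eqr_nat eqSS => /eqP.
  rewrite !measure_semi_bigcup//; [|exact: bigcupT_measurable..].
  apply: eq_eseriesr => n _.
  have [nB|nB] := pselect (B n.+1%:R).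
    by rewrite setIidr; [exact: munu|move=> x /= ->].
  rewrite (_ : _ `&` _ = set0) ?measure0//.
  by apply/seteqP; split=> // x [] /[swap] /= ->.
have null (m : probability (measurableTypeR R) R) : m S = 1%E -> m (A `\` S) = 0%E.
  move=> mS1; apply/eqP; rewrite -measure_le0 -(subee (x := 1))// -{2}mS1.
  rewrite -probability_setC//; apply: le_measure; rewrite ?inE//.
  - exact: measurableD.
  - exact: measurableC.
have muS : mu S = 1%E by rewrite -nuS -[S]setTI eqS.
rewrite (measureDI mu mA mS) (measureDI nu mA mS); congr (_ + _)%E.
  exact: etrans (null _ muS) (esym (null _ nuS)).
exact: eqS.
Qed.

(** The law puts mass q n - q n.+1 at n.+1, so that q n is the mass of ]n, +oo[;
all the sums telescope. *)
Lemma discrete_law_exists (q : nat -> R) : q 0%N = 1 ->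
  {homo q : m n / (m <= n)%N >-> n <= m} -> q n @[n --> \oo] --> 0 ->
  exists Y : probability (measurableTypeR R) R,
    [/\ forall n : nat, Y [set n.+1%:R] = (q n - q n.+1)%:E,
        Y (\bigcup_n [set n.+1%:R]) = 1%E,
        forall y : R, 0 <= y -> Y `]-oo, y]%classic = (1 - q (Num.truncn y))%:E
      & forall y : R, y < 0 -> Y `]-oo, y]%classic = 0%E].
Proof.
move=> q0 q_dec q_lim.
have w_ge0 n : 0 <= q n - q n.+1 by rewrite subr_ge0 q_dec.
pose m n : {measure set (measurableTypeR R) -> \bar R} :=
  mscale (NngNum (w_ge0 n)) (@dirac _ (measurableTypeR R) n.+1%:R R).
have mE n A : m n A = ((q n - q n.+1) * (n.+1%:R \in A)%:R)%:E.
  by rewrite EFinM -indicE.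
pose Y0 := mseries m 0.
(* Evaluates the series of Dirac masses as an ordinary limit of real sums. *)
have Y0E A l : (\sum_(i < n) (q i - q i.+1) * (i.+1%:R \in A)%:R) @[n --> \oo] --> l ->
    Y0 A = l%:E.
  move=> ul; apply: cvg_lim => //.
  under eq_fun => n do rewrite big_mkord (eq_bigr _ (fun i _ => mE _ _)) sumEFin.
  by apply: cvg_EFin; [exact: nearW|].
have sum_q n : \sum_(i < n) (q i - q i.+1) = 1 - q n.
  rewrite -(big_mkord predT (fun i => q i - q i.+1)).
  by rewrite (telescope_sumr_eq (fun i => - q i))// => [|i _]; rewrite ?q0 opprK addrC.
have sum_q_cvg : (1 - q n) @[n --> \oo] --> (1 : R).
  by rewrite -[X in _ --> X]subr0; apply: cvgB => //; exact: cvg_cst.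
have Y0_full A : (forall n, A n.+1%:R) -> Y0 A = 1%E.
  move=> AN; apply: Y0E; apply: cvg_trans sum_q_cvg; apply: near_eq_cvg.
  apply: nearW => n.
  by rewrite -sum_q; apply: eq_bigr => i _; rewrite mem_set ?mulr1.
have [Y YE] : exists Y : probability (measurableTypeR R) R, forall A, Y A = Y0 A.
  pose Y0m : {measure set (measurableTypeR R) -> \bar R} := mseries m 0.
  pose YP := Measure_isProbability.Build _ _ _ Y0m (Y0_full _ (fun=> I)).
  by exists (HB.pack Y0 Y0m YP : probability (measurableTypeR R) R).
exists Y; split; [|rewrite YE| |].
- move=> n; rewrite YE; apply: Y0E; apply: cvg_near_cst; exists n.+1 => // N /= nN.
  rewrite (bigD1 (Ordinal nN))//= mem_set// mulr1 big1 ?addr0// => i iN.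
  rewrite memNset ?mulr0//= => /eqP; rewrite eqr_nat eqSS => /eqP iE.
  by move/eqP : iN; apply; exact: val_inj.
- by apply: Y0_full => n; exists n.
- move=> y y0; rewrite YE; apply: Y0E; apply: cvg_near_cst.
  exists (Num.truncn y) => // N /= tN.
  rewrite -sum_q (big_ord_widen_cond _ predT (fun i => q i - q i.+1) tN).
  rewrite [RHS]big_mkcond/=; apply: eq_bigr => i _.
  have := truncn_ge_nat i.+1 y0; case: ifPn => [iy iE|iy iE].
    by rewrite mem_set ?mulr1//= in_itv/= -iE.
  by rewrite memNset ?mulr0//= in_itv/= -iE; exact/negP.
- move=> y y0; rewrite YE; apply: Y0E; apply: cvg_near_cst; apply: nearW => N.
  rewrite big1// => i _; rewrite memNset ?mulr0//= in_itv/= => iy.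
  by have := lt_le_trans (le_lt_trans iy y0) (ler0n _ i.+1); rewrite ltxx.
Qed.

End discrete_law.

Section cdf_unique.
Context {R : realType}.

(** The half-lines ]-oo, x] are stable under intersection and generate the Borel
sets. *)
Lemma cdf_unique (mu nu : probability (measurableTypeR R) R) :
  (forall y : R, mu `]-oo, y]%classic = nu `]-oo, y]%classic) ->
  forall A : set R, measurable A -> mu A = nu A.
Proof.
move=> munu A mA.
pose G := [set B | exists x : R, B = `]-oo, x]%classic].
apply: (@measure_unique _ R (measurableTypeR R) G
  (fun n => `]-oo, n%:R]%classic) _ _ _ _ mu nu) => //.
- rewrite eqEsubset; split => B.
    rewrite measurable_realfun.RGenOInfty.measurableE => mB.
    apply: (smallest_sub _ _ mB); first exact: smallest_sigma_algebra.
    have [_ GC _] := smallest_sigma_algebra setT G.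
    move=> _ [x ->]; rewrite -setCitvl -setTD; apply: GC.
    by apply: sub_sigma_algebra; exists x.
  apply: smallest_sub; first exact: sigma_algebra_measurable.
  by move=> _ [x ->]; exact: measurable_itv.
- move=> _ _ [x ->] [y ->]; exists (Num.min x y).
  apply/seteqP; split=> z /=; rewrite !in_itv/= le_min; first by move=> [-> ->].
  by move=> /andP.
- by move=> i; exists i%:R.
- rewrite -subTset => x _; exists (Num.truncn x).+1 => //=.
  by rewrite in_itv/= ltW// truncnS_gt.
- by move=> _ [x ->]; exact: munu.
- by move=> k; rewrite -ge0_fin_numE// fin_num_measure.
Qed.

End cdf_unique.

Section laws.
Context {R : realType}.

(** Transports the uniqueness of a law from probability measures on the line to
the distribution of a random variable. *)
Lemma has_law_eq d (Om : measurableType d) (P : probability Om R) (X : Om -> R)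
    (nu : probability (measurableTypeR R) R) :
  measurable_fun setT X ->
  (forall mu : probability (measurableTypeR R) R,
     (forall A : set R, mu A = P (X @^-1` A)) ->
     forall A : set R, measurable A -> mu A = nu A) ->
  has_law P X nu.
Proof.
move=> mX eq_law A mA.
have mX' : measurable_fun setT (X : Om -> measurableTypeR R) by exact: mX.
pose XB := isMeasurableFun.Build _ _ _ _ (X : Om -> measurableTypeR R) mX'.
pose X' : {RV P >-> measurableTypeR R} := HB.pack (X : Om -> measurableTypeR R) XB.
by rewrite -(eq_law (distribution P X')).
Qed.

End laws.

(** * The beta and exponential laws and the mixture of geometric laws *)

Section beta1.
Context {R : realType}.
Local Notation mu := lebesgue_measure.

(** Distribution function of the uniform law on [0, 1]. *)
Definition clamp01 (y : R) : R := Num.max 0 (Num.min 1 y).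

Lemma integral_onemXn (n : nat) (y : R) : 0 <= y ->
  (\int[mu]_(x in `[0%R, y]) ((1 - x) ^+ n)%R%:E)%E =
    ((1 - (1 - y) ^+ n.+1) / n.+1%:R)%:E.
Proof.
rewrite le_eqVlt => /orP[/eqP<-|y0].
  by rewrite set_itv1 integral_set1 subr0 expr1n subrr mul0r.
rewrite (@continuous_FTC2 _ _ (fun x => (onem x) ^+ n.+1 / - n.+1%:R))//=.
- rewrite onem0 expr1n/= -EFinB; congr EFin; rewrite /onem; field.
  by rewrite nat1r pnatr_eq0.
- by apply: continuous_in_subspaceT => x x01; exact: continuous_onemXn.
- split.
  + by move=> x _; apply: derivableM => //=; exact: onemXn_derivable.
  + by apply: cvg_at_right_filter; apply: cvgM; [exact: continuous_onemXn|exact: cvg_cst].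
  + by apply: cvg_at_left_filter; apply: cvgM; [exact: continuous_onemXn|exact: cvg_cst].
- move=> x _; rewrite derive1Mr//; last exact: onemXn_derivable.
  by rewrite derive_onemXn mulrAC divff ?mul1r// oppr_eq0 pnatr_eq0.
Qed.

(** The density k (1 - x)^(k-1) has the primitive - (1 - x)^k. *)
Lemma beta1_cdf (k : nat) (y : R) : (0 < k)%N ->
  beta_prob 1 k `]-oo, y]%classic = (1 - (1 - clamp01 y) ^+ k)%:E.
Proof.
case: k => // k _.
have [y0|y0] := ltP y 0.
  rewrite /clamp01 /Num.max ltNge ge_min (ltW y0) orbT/= subr0 expr1n subrr.
  rewrite -integral_beta_pdf//; apply: integral0_eq => x; rewrite /= in_itv/= => xy.
  rewrite /beta_pdf patchE memNset ?mul0r//= in_itv/= => /andP[x0 _].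
  by have := lt_le_trans (le_lt_trans xy y0) x0; rewrite ltxx.
have -> : clamp01 y = Num.min 1 y by apply/max_idPr; rewrite le_min ler01.
rewrite /beta_prob/= /mscale/= integral_XMonemX_restrict.
rewrite (_ : _ `&` _ = `[0, Num.min 1 y]%classic); last first.
  by apply/seteqP; split=> z /=; rewrite !in_itv/= le_min => /andP; lra.
under eq_integral do rewrite XMonemX0n.
rewrite integral_onemXn ?le_min ?ler01// beta_fun1Sn invrK -EFinM.
by congr EFin; field; rewrite nat1r pnatr_eq0.
Qed.

End beta1.

Section exponential.
Context {R : realType}.

Lemma exponential_cdf (y : R) :
  exponential_prob (1 : R) `]-oo, y]%classic = (1 - expR (- Num.max 0 y))%:E.
Proof.
have [y0|y0] := leP 0 y; last first.
  rewrite oppr0 expR0 subrr; apply: integral0_eq => x /=.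
  by rewrite in_itv/= => xy; rewrite lt0_exponential_pdf// (le_lt_trans xy).
have -> : exponential_prob 1 `]-oo, y]%classic = exponential_prob 1 `[0, y]%classic.
  rewrite /exponential_prob [LHS]integral_mkcond [RHS]integral_mkcond.
  apply: eq_integral => x _; rewrite !patchE.
  have [x0|x0] := ltP x 0; first by rewrite lt0_exponential_pdf// !if_same.
  by congr (if _ then _ else _); apply/idP/idP; rewrite !inE/= !in_itv/= x0.
move: y0; rewrite le_eqVlt => /orP[/eqP<-|y0].
  by rewrite oppr0 expR0 subrr set_itv1 /exponential_prob integral_set1.
by rewrite exponential_prob_itv0c// mulN1r EFinB.
Qed.

End exponential.

Section laws_of_random_variables.
Context {R : realType}.

(** The minimum exceeds y if and only if all the variables do, which by
independence has probability (1 - y)^k for y in [0, 1]. *)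
Lemma min_uniform_law d (Om : measurableType d) (P : probability Om R) (k : nat)
    (U : 'I_k -> {RV P >-> R}) (i0 : 'I_k) :
  mutually_independent U ->
  (forall i, has_law P (U i) (uniform_prob (@ltr01 R))) ->
  has_law P (fun w => \big[Num.min/U i0 w]_(i < k) U i w) (beta_prob 1 k).
Proof.
move=> indepU unifU.
have k0 : (0 < k)%N := leq_ltn_trans (leq0n i0) (ltn_ord i0).
pose W w := \big[Num.min/U i0 w]_(i < k) U i w.
have mW : measurable_fun setT W.
  rewrite /W; elim: index_enum => [|i s IHs].
    by under eq_fun do rewrite big_nil; exact: measurable_funP.
  under eq_fun do rewrite big_cons.
  exact: measurable_minr.
apply: has_law_eq => // mu muE; apply: cdf_unique => y; rewrite muE.
apply: etrans _ (esym (beta1_cdf _ k0)); rewrite -/W -setCitvr -preimage_setC.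
rewrite probability_setC; last by rewrite -[X in measurable X]setTI; exact: mW.
have -> : W @^-1` `]y, +oo[ = \bigcap_(i in [set` [set: 'I_k]%SET]) U i @^-1` `]y, +oo[.
  apply/seteqP; split => w /=; rewrite in_itv/= andbT.
    move=> yW i _ /=; rewrite in_itv/= andbT; apply: lt_le_trans yW _.
    by rewrite /W (bigD1 i)//= ge_min lexx.
  move=> yU; have yUi i : y < U i w.
    by have /= := yU i; rewrite inE in_itv/= andbT; apply.
  by rewrite /W; elim/big_ind: _ => // a b ya yb; rewrite lt_min ya.
rewrite (indepU _ (fun=> `]y, +oo[%classic))//.
(* The uniform law is Beta(1, 1), whose distribution function is known. *)
have PU i : P (U i @^-1` `]y, +oo[) = (1 - clamp01 y)%:E.
  rewrite unifU// -setCitvl.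
  have := @probability_setC _ _ _ (uniform_prob (@ltr01 R))
    `]-oo, y]%classic (measurable_itv _).
  move=> /= ->; rewrite -beta_prob_uniform beta1_cdf// expr1 -EFinB.
  by congr EFin; ring.
under eq_bigr do rewrite PU.
by rewrite prodEFin prodr_const cardsT card_ord -EFinB.
Qed.

(** Conditioning on I1 gives the atoms of the mixture; [discrete_law_unique] then
gives all other sets, because the atoms of Y have total mass 1. *)
Lemma mixture_law d (Om : measurableType d) (P : probability Om R) (a : R)
    (I1 : {RV P >-> bool}) (G G' : {RV P >-> R}) (Y : probability (measurableTypeR R) R)
    (p p' : R) :
  0 <= a <= 1 ->
  has_law P I1 (bernoulli_prob a) ->
  geometric_rv p G -> geometric_rv p' G' ->
  independent2 I1 G -> independent2 I1 G' ->
  (forall n : nat, Y [set n.+1%:R] =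
     (a * (p * (1 - p) ^+ n) + (1 - a) * (p' * (1 - p') ^+ n))%:E) ->
  Y (\bigcup_n [set n.+1%:R]) = 1%E ->
  has_law P (fun w => (I1 w)%:R * G w + (1 - (I1 w)%:R) * G' w) Y.
Proof.
move=> a01 lawI geoG geoG' indG indG' Y1 YN.
pose W w := (I1 w)%:R * G w + (1 - (I1 w)%:R) * G' w.
have mI : measurable_fun setT (fun w => (I1 w)%:R : R).
  by apply: (measurableT_comp (f := fun b : bool => b%:R : R)) => //.
have mW : measurable_fun setT W.
  apply: measurable_funD; apply: measurable_funM => //.
  exact: measurable_funB.
apply: has_law_eq => // mu muE; apply: (discrete_law_unique _ YN) => n.
rewrite muE Y1 -/W.
have bern (b : bool) : P (I1 @^-1` [set b]) = (if b then a else 1 - a)%:E.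
  by rewrite lawI// /bernoulli_prob a01 fsbig_set1.
have -> : W @^-1` [set n.+1%:R] =
   (I1 @^-1` [set true] `&` G @^-1` [set n.+1%:R]) `|`
   (I1 @^-1` [set false] `&` G' @^-1` [set n.+1%:R]).
  apply/seteqP; rewrite /W; split=> w /=.
    by case: (I1 w); rewrite ?subrr ?subr0 ?mul0r ?mul1r ?addr0 ?add0r; [left|right].
  by case=> -[-> ->]; rewrite ?subrr ?subr0 ?mul0r ?mul1r ?addr0 ?add0r.
have mP d' (T' : measurableType d') (X : {RV P >-> T'}) B :
    measurable B -> measurable (X @^-1` B).
  by move=> mB; rewrite -[X in measurable X]setTI; exact: measurable_funP.
rewrite measureU; [|by apply: measurableI; exact: mP..|]; last first.
  by apply/seteqP; split=> w //= [[-> _] []].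
have geo (X : {RV P >-> R}) r : geometric_rv r X ->
    P (X @^-1` [set n.+1%:R]) = (r * (1 - r) ^+ n)%:E.
  by move=> /(_ n.+1 isT) <-; rewrite fineK// fin_num_measure//; exact: mP.
rewrite EFinD; congr (_ + _)%E.
  by apply: etrans (indG _ _ _ _) _ => //; rewrite bern (geo _ _ geoG).
by apply: etrans (indG' _ _ _ _) _ => //; rewrite bern (geo _ _ geoG').
Qed.

End laws_of_random_variables.

Section mixture_of_geometrics.
Context {R : realType}.

(** The sequence q n = a^(n+1) + b^(n+1) starts from a + b = 1 and decreases to 0,
so it is the tail of a law; as 1 - a = b and 1 - b = a, its increments are those
of the mixture of geometric laws with parameters b and a. *)
Lemma geometric_mixture_exists (rho : R) : 0 < rho ->
  let a := 1 / (1 + rho) in let b := rho / (1 + rho) in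
  exists Y : probability (measurableTypeR R) R,
  [/\ forall n : nat, Y [set n.+1%:R] = (a * (b * a ^+ n) + b * (a * b ^+ n))%:E,
      Y (\bigcup_n [set n.+1%:R]) = 1%E,
      forall y : R, 0 <= y ->
        Y `]-oo, y]%classic =
        (1 - (a ^+ (Num.truncn y).+1 + b ^+ (Num.truncn y).+1))%:E
    & forall y : R, y < 0 -> Y `]-oo, y]%classic = 0%E].
Proof.
move=> rho0 a b; have rho1 : 0 < 1 + rho by rewrite ltr_wpDr// ltW.
have ab1 : a + b = 1 by rewrite /a /b -mulrDl divff// gt_eqF.
have a0 : 0 < a by rewrite divr_gt0.
have b0 : 0 < b by rewrite divr_gt0.
clearbody a b.
have a1 : a < 1 by lra.
have b1 : b < 1 by lra.
pose q n := a ^+ n.+1 + b ^+ n.+1.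
have q0 : q 0%N = 1 by rewrite /q !expr1.
have q_dec : {homo q : m n / (m <= n)%N >-> n <= m}.
  by move=> m n mn; apply: lerD; apply: ler_wiXn2l => //; exact: ltW.
have q_lim : q n @[n --> \oo] --> 0.
  rewrite -[X in _ --> X]addr0; apply: cvgD.
    by rewrite (cvg_shiftS (fun n => a ^+ n)); apply: cvg_expr; rewrite gtr0_norm.
  by rewrite (cvg_shiftS (fun n => b ^+ n)); apply: cvg_expr; rewrite gtr0_norm.
have [Y [Y1 YN Yge0 Ylt0]] := discrete_law_exists q0 q_dec q_lim.
exists Y; split => // n; rewrite Y1 /q !exprS; congr EFin.
have -> : b = 1 - a by lra.
by ring.
Qed.

End mixture_of_geometrics.

(** * Asymptotics of quotients of falling factorials *)

Section ffact_ratio.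
Context {R : realType}.

Lemma ffactnD (n k l : nat) : (n ^_ (k + l) = n ^_ k * (n - k) ^_ l)%N.
Proof.
elim: l => [|l IHl]; first by rewrite addn0 muln1.
by rewrite addnS !ffactnSr IHl subnDA mulnA.
Qed.

Lemma ffact_ratioS (m n l : nat) :
  (m ^_ l.+1)%:R / (n ^_ l.+1)%:R =
  (m ^_ l)%:R / (n ^_ l)%:R * ((m - l)%:R / (n - l)%:R) :> R.
Proof. by rewrite !ffactnSr !natrM invfM mulrACA. Qed.

(** Both sides become equal to (n + k)_(k + l) after clearing denominators. *)
Lemma ffact_ratio_sym (n k l : nat) : (0 < k)%N ->
  (n ^_ l)%:R / ((n + k) ^_ l)%:R = ((n + k - l) ^_ k)%:R / ((n + k) ^_ k)%:R :> R.
Proof.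
move=> k0; have [ln|nl] := leqP l (n + k); last first.
  rewrite [(n + k) ^_ l]ffact_small// invr0 mulr0.
  by rewrite (eqP (_ : n + k - l == 0)%N) ?subn_eq0 1?ltnW// ffact_small// mul0r.
apply/eqP; rewrite eqr_div ?pnatr_eq0 -?lt0n ?ffact_gt0 ?leq_addl// -!natrM.
by rewrite -{1}(addnK k n) mulnC [X in _ == X%:R]mulnC -!ffactnD [(l + k)%N]addnC.
Qed.

(** The factors (m - i) / (n - i) decrease with i when m <= n; the largest is
m / n. *)
Lemma ffact_ratio_le (m n l : nat) : (m <= n)%N ->
  (m ^_ l)%:R / (n ^_ l)%:R <= (m%:R / n%:R) ^+ l :> R.
Proof.
move=> mn; elim: l => [|l IHl]; first by rewrite !ffactn0 divr1 expr0.
rewrite ffact_ratioS exprSr ler_pM ?divr_ge0//.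
have [nl|ln] := leqP n l.
  by rewrite (eqP (_ : n - l == 0)%N) ?invr0 ?mulr0 ?divr_ge0// subn_eq0.
have n0 : (0 < n)%N := leq_ltn_trans (leq0n l) ln.
rewrite ler_pdivrMr ?ltr0n ?subn_gt0// mulrAC ler_pdivlMr ?ltr0n//.
by rewrite -!natrM ler_nat mulnBl mulnBr leq_sub2l// mulnC leq_mul2l mn orbT.
Qed.

(** All the factors with index i <= l are at least the one with index l. *)
Lemma ffact_ratio_ge (m n l : nat) : (m <= n)%N -> (l < n)%N ->
  ((m - l)%:R / (n - l)%:R) ^+ l <= (m ^_ l)%:R / (n ^_ l)%:R :> R.
Proof.
move=> mn ln; suff H i : (i <= l)%N ->
    ((m - l)%:R / (n - l)%:R) ^+ i <= (m ^_ i)%:R / (n ^_ i)%:R :> R by exact: H.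
elim: i => [|i IHi] il; first by rewrite !ffactn0 divr1 expr0.
rewrite ffact_ratioS exprSr ler_pM ?exprn_ge0 ?divr_ge0// ?IHi 1?ltnW//.
have i_n := ltn_trans il ln.
rewrite ler_pdivrMr ?ltr0n ?subn_gt0// mulrAC ler_pdivlMr ?ltr0n ?subn_gt0//.
rewrite -!natrM ler_nat.
have [ml|lm] := leqP m l; first by rewrite (eqP (_ : m - l == 0)%N) ?subn_eq0.
nia.
Qed.

Lemma near_cvgn (f g : nat -> R) (l : R) : (\forall n \near \oo, f n = g n) ->
  f n @[n --> \oo] --> l -> g n @[n --> \oo] --> l.
Proof.
by move=> fg; apply: cvg_trans; apply: near_eq_cvg; apply: filterS fg => n /= ->.
Qed.

Lemma cvg_natrV : n%:R^-1 @[n --> \oo] --> (0 : R).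
Proof. by rewrite -cvg_shiftS; exact: cvg_harmonic. Qed.

(** The truncated subtraction changes u n by at most j, which is negligible with
respect to n. *)
Lemma cvg_subn_ratio (u : nat -> nat) (c : R) (j : nat) :
  (u n)%:R / n%:R @[n --> \oo] --> c -> (u n - j)%:R / n%:R @[n --> \oo] --> c.
Proof.
move=> uc.
have jc : (u n)%:R / n%:R - j%:R / n%:R @[n --> \oo] --> c.
  rewrite -[X in _ --> X]subr0; apply: cvgB => //.
  rewrite -[X in _ --> X](mulr0 j%:R).
  by apply: cvgM; [exact: cvg_cst|exact: cvg_natrV].
apply: squeeze_cvgr jc uc; apply: nearW => n.
rewrite -mulrBl !ler_wpM2r ?invr_ge0 ?ler_nat ?leq_subr//.
by rewrite lerBlDr -natrD ler_nat; lia.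
Qed.

(** With a fixed number k of factors, each factor tends to a / b. *)
Lemma cvg_ffact_ratio (u v : nat -> nat) (a b : R) (k : nat) : b != 0 ->
  (u n)%:R / n%:R @[n --> \oo] --> a -> (v n)%:R / n%:R @[n --> \oo] --> b ->
  (u n ^_ k)%:R / (v n ^_ k)%:R @[n --> \oo] --> (a / b) ^+ k.
Proof.
move=> b0 ua vb; elim: k => [|k IHk].
  by under eq_fun do rewrite !ffactn0 divr1; exact: cvg_cst.
under eq_fun do rewrite ffact_ratioS.
rewrite exprSr; apply: cvgM => //.
have uv := cvgM (cvg_subn_ratio k ua) (cvgV b0 (cvg_subn_ratio k vb)).
apply: (near_cvgn _ (uv _ _)); near=> n.
have n0 : n%:R != 0 :> R by rewrite pnatr_eq0 -lt0n; near: n; exact: nbhs_infty_gt.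
by rewrite /= invfM invrK mulrACA mulVf// mulr1.
Unshelve. all: by end_near. Qed.

End ffact_ratio.

Section limits.
Context {R : realType}.

(** By [ffact_ratio_ge] and [ffact_ratio_le], and by 1 + x <= exp x for
x = b / (n - l) and x = - b / (n + b), the quotient lies between
exp (- l b / (n - l)) and exp (- l b / (n + b)); both exponents tend to - y. *)
Lemma cvg_ffact_ratio_exp (b l : nat -> nat) (y : R) :
  (b n)%:R / n%:R @[n --> \oo] --> (0 : R) ->
  (l n)%:R / n%:R @[n --> \oo] --> (0 : R) ->
  (l n)%:R * ((b n)%:R / n%:R) @[n --> \oo] --> y ->
  (n ^_ l n)%:R / ((n + b n) ^_ l n)%:R @[n --> \oo] --> expR (- y).
Proof.
move=> bn ln lby.
have expC (f : nat -> R) : f n @[n --> \oo] --> y ->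
    expR (- f n) @[n --> \oo] --> expR (- y).
  by move=> fy; apply: (cvg_comp _ _ (cvgN fy)); exact: continuous_expR.
have loC : (l n)%:R * ((b n)%:R / n%:R) / (1 - (l n)%:R / n%:R) @[n --> \oo] --> y.
  rewrite -[X in _ --> X]divr1; apply: cvgM => //; apply: cvgV => //.
  by rewrite -[X in _ --> X]subr0; apply: cvgB => //; exact: cvg_cst.
have upC : (l n)%:R * ((b n)%:R / n%:R) / (1 + (b n)%:R / n%:R) @[n --> \oo] --> y.
  rewrite -[X in _ --> X]divr1; apply: cvgM => //; apply: cvgV => //.
  by rewrite -[X in _ --> X]addr0; apply: cvgD => //; exact: cvg_cst.
apply: (squeeze_cvgr _ (expC _ loC) (expC _ upC)); near=> n.
have n0 : (0 < n)%N by near: n; exact: nbhs_infty_gt.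
have nR : 0 < n%:R :> R by rewrite ltr0n.
have l_n : (l n < n)%N.
  rewrite -(ltr_nat R) -[X in _ < X]mul1r -ltr_pdivrMr//.
  by near: n; exact: (cvgr_lt _ ln).
have l_nR : (l n)%:R < n%:R :> R by rewrite ltr_nat.
have b0 : 0 <= (b n)%:R :> R by [].
apply/andP; split.
  apply: le_trans (ffact_ratio_ge _ _); last 2 first.
  - exact: leq_addr.
  - by rewrite (leq_trans l_n)// leq_addr.
  have -> : (n + b n - l n = (n - l n) + b n)%N by lia.
  rewrite natrD natrB 1?ltnW//.
  set x : R := n%:R - (l n)%:R; have x0 : 0 < x by rewrite subr_gt0.
  have -> : - ((l n)%:R * ((b n)%:R / n%:R) / (1 - (l n)%:R / n%:R)) =
      (l n)%:R * - ((b n)%:R / x) :> R.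
    rewrite /x; field; rewrite !gt_eqF//.
  clearbody x; rewrite expRM_natl; apply: lerXn2r.
  - by rewrite nnegrE expR_ge0.
  - by rewrite nnegrE divr_ge0 ?(ltW x0)// addr_ge0 ?(ltW x0).
  rewrite expRN -[leRHS]invrK lef_pV2 ?posrE ?expR_gt0 ?invr_gt0 ?divr_gt0 ?ltr_wpDr//.
  by rewrite invf_div mulrDl divff ?gt_eqF// expR_ge1Dx.
apply: le_trans (ffact_ratio_le (l n) _) _; first exact: leq_addr.
have -> : - ((l n)%:R * ((b n)%:R / n%:R) / (1 + (b n)%:R / n%:R)) =
      (l n)%:R * - ((b n)%:R / (n%:R + (b n)%:R)) :> R.
  by field; rewrite !gt_eqF// ltr_wpDr.
rewrite expRM_natl natrD; apply: lerXn2r.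
- by rewrite nnegrE divr_ge0.
- by rewrite nnegrE expR_ge0.
apply: le_trans (expR_ge1Dx _); rewrite le_eqVlt; apply/orP; left; apply/eqP.
by field; rewrite gt_eqF// ltr_wpDr.
Unshelve. all: by end_near. Qed.

(** At least one factor occurs and none exceeds b / (n + b) <= b / n. *)
Lemma cvg_minor (b l : nat -> nat) : (forall n, 0 < l n)%N ->
  (b n)%:R / n%:R @[n --> \oo] --> (0 : R) ->
  (b n ^_ l n)%:R / ((n + b n) ^_ l n)%:R @[n --> \oo] --> (0 : R).
Proof.
move=> l0 bn; apply: (squeeze_cvgr _ (cvg_cst _) bn); near=> n.
have n0 : (0 < n)%N by near: n; exact: nbhs_infty_gt.
rewrite divr_ge0//= (le_trans (ffact_ratio_le (l n) _)) ?leq_addl//.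
have nb0 : 0 < (n + b n)%:R :> R by rewrite ltr0n addn_gt0 n0.
rewrite (le_trans (ler_iXnr (l0 n) _ _)) ?divr_ge0//.
  by rewrite ler_pdivrMr// mul1r ler_nat leq_addl.
by rewrite ler_wpM2l// lef_pV2 ?posrE ?ltr0n ?addn_gt0 ?n0// ler_nat leq_addr.
Unshelve. all: by end_near. Qed.

Lemma run_tailE (m1 m2 l : nat) :
  run_tail m1 m2 l = (m1 ^_ l)%:R / ((m1 + m2) ^_ l)%:R +
                     (m2 ^_ l)%:R / ((m1 + m2) ^_ l)%:R :> R.
Proof. by rewrite /run_tail natrD mulrDl. Qed.

End limits.

(** * Limits of the tail of the number of sure hits *)

Section tails.
Context {R : realType}.

(** The index l = floor (y / a) + 1 satisfies y < l a <= y + a. *)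
Lemma cvg_truncnS_mul (a : nat -> R) (y : R) : 0 <= y ->
  (\forall n \near \oo, 0 < a n) -> a n @[n --> \oo] --> 0 ->
  (Num.truncn (y / a n)).+1%:R * a n @[n --> \oo] --> y.
Proof.
move=> y0 a_gt0 a0.
have up : y + a n @[n --> \oo] --> y.
  by rewrite -[X in _ --> X]addr0; apply: cvgD => //; exact: cvg_cst.
apply: (squeeze_cvgr _ (cvg_cst y) up); near=> n.
have an : 0 < a n by near: n.
have /andP[lo hi] := truncn_itv (divr_ge0 y0 (ltW an)).
rewrite -ler_pdivrMr// ltW//= mulrSr mulrDl mul1r lerD2r.
by rewrite -ler_pdivlMr.
Unshelve. all: by end_near. Qed.

(** The hypothesis is the unfolded form of m2 = rho n + o(n), which for rho = 0 is
m2 = o(n). *)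
Lemma cvg_ratio_of_equiv (m2 : nat -> nat) (rho : R) :
  (forall e : R, 0 < e -> \forall n \near \oo,
     `|(m2 n)%:R - rho * n%:R| <= e * n%:R) ->
  (m2 n)%:R / n%:R @[n --> \oo] --> rho.
Proof.
move=> H; apply/cvgrPdist_le => e e0; near=> n.
have nR : 0 < n%:R :> R by rewrite ltr0n; near: n; exact: nbhs_infty_gt.
rewrite distrC -(ler_pM2r nR) -[X in _ * X <= _]gtr0_norm//.
rewrite -normrM mulrBl divfK ?gt_eqF//.
by near: n; exact: H.
Unshelve. all: by end_near. Qed.

Lemma cvg_run_tail (m2 l : nat -> nat) (F F' : R) :
  (n ^_ l n)%:R / ((n + m2 n) ^_ l n)%:R @[n --> \oo] --> F ->
  (m2 n ^_ l n)%:R / ((n + m2 n) ^_ l n)%:R @[n --> \oo] --> F' ->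
  run_tail n (m2 n) (l n) @[n --> \oo] --> F + F'.
Proof. by move=> HF HF'; under eq_fun do rewrite run_tailE; exact: cvgD. Qed.

(** For y >= 1 the run would be longer than the number of cards of either colour,
and the tail vanishes from some point on. *)
Lemma cvg_run_tail_fixed (m2 : nat -> nat) (k : nat) (y : R) : (0 < k)%N ->
  (\forall n \near \oo, m2 n = k) -> 0 <= y ->
  run_tail n (m2 n) (Num.truncn (y / n%:R^-1)).+1 @[n --> \oo] --> (1 - clamp01 y) ^+ k.
Proof.
move=> k0 m2k y0; pose l (n : nat) := (Num.truncn (y / n%:R^-1)).+1.
apply: (@near_cvgn _ (fun n => run_tail n k (l n))).
  by apply: filterS m2k => n ->.
have clampE : clamp01 y = Num.min 1 y by apply/max_idPr; rewrite le_min ler01.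
have kn : k%:R / n%:R @[n --> \oo] --> (0 : R).
  by rewrite -[X in _ --> X](mulr0 k%:R); apply: cvgM; [exact: cvg_cst|exact: cvg_natrV].
have [y1|y1] := ltP y 1; last first.
  rewrite clampE (min_idPl y1) subrr expr0n gtn_eqF//=; apply: cvg_near_cst; near=> n.
  have nl : (n < l n)%N.
    rewrite ltnS truncn_ge_nat; last by rewrite invrK mulr_ge0.
    by rewrite invrK ler_peMl.
  have kl : (k < l n)%N by apply: leq_ltn_trans nl; near: n; exact: nbhs_infty_ge.
  by rewrite /run_tail (ffact_small nl) (ffact_small kl) mul0r.
rewrite clampE (min_idPr (ltW y1)).
rewrite -[X in _ --> X]addr0; apply: (@cvg_run_tail (fun=> k) l); last exact: cvg_minor.
rewrite -[X in X ^+ k]divr1.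
under eq_fun do rewrite ffact_ratio_sym//.
apply: (@cvg_ffact_ratio _ (fun n => n + k - l n)%N (fun n => n + k)%N) => //.
  have ly : (l n)%:R * n%:R^-1 @[n --> \oo] --> y.
    apply: cvg_truncnS_mul => //; last exact: cvg_natrV.
    by near=> n; rewrite invr_gt0 ltr0n; near: n; exact: nbhs_infty_gt.
  have lim : 1 + k%:R / n%:R - (l n)%:R * n%:R^-1 @[n --> \oo] --> 1 + 0 - y.
    by apply: cvgB => //; apply: cvgD => //; exact: cvg_cst.
  rewrite addr0 in lim; apply: (near_cvgn _ lim); near=> n.
  have n0 : (0 < n)%N by near: n; exact: nbhs_infty_gt.
  have nR : 0 < n%:R :> R by rewrite ltr0n.
  have l_n : (l n <= n + k)%N.
    rewrite (@leq_trans n) ?leq_addr// -(ltr_nat R).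
    have yn0 : 0 <= y / n%:R^-1 by rewrite invrK mulr_ge0.
    have /andP[lo _] := truncn_itv yn0.
    by rewrite (le_lt_trans lo)// invrK gtr_pMl.
  by rewrite natrB// natrD !mulrDl divff ?gt_eqF// mulNr.
have lim : 1 + k%:R / n%:R @[n --> \oo] --> 1 + (0 : R).
  by apply: cvgD => //; exact: cvg_cst.
rewrite addr0 in lim; apply: (near_cvgn _ lim); near=> n.
have n0 : (0 < n)%N by near: n; exact: nbhs_infty_gt.
by rewrite natrD mulrDl divff// pnatr_eq0 -lt0n.
Unshelve. all: by end_near. Qed.

Lemma cvg_run_tail_exp (m2 : nat -> nat) (y : R) : 0 <= y ->
  (m2 n)%:R / n%:R @[n --> \oo] --> (0 : R) ->
  (m2 n)%:R @[n --> \oo] --> (+oo : set_system R) ->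
  run_tail n (m2 n) (Num.truncn (y / ((m2 n)%:R / n%:R))).+1 @[n --> \oo] --> expR (- y).
Proof.
move=> y0 m2n m2y; pose l (n : nat) := (Num.truncn (y / ((m2 n)%:R / n%:R))).+1.
have a_gt0 : \forall n \near \oo, 0 < (m2 n)%:R / n%:R :> R.
  near=> n; rewrite divr_gt0//; last by rewrite ltr0n; near: n; exact: nbhs_infty_gt.
  by near: n; apply: cvgry_gt.
have ly : (l n)%:R * ((m2 n)%:R / n%:R) @[n --> \oo] --> y by exact: cvg_truncnS_mul.
rewrite -[X in _ --> X]addr0; apply: (@cvg_run_tail m2 l); last exact: cvg_minor.
apply: (@cvg_ffact_ratio_exp _ _ l) => //.
have m2V : ((m2 n)%:R)^-1 @[n --> \oo] --> (0 : R).
  by apply/gtr0_cvgV0 => //; near=> n; near: n; exact: cvgry_gt.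
have lim : (l n)%:R * ((m2 n)%:R / n%:R) * ((m2 n)%:R)^-1 @[n --> \oo] --> y * 0.
  exact: cvgM.
rewrite mulr0 in lim; apply: (near_cvgn _ lim); near=> n.
have m2n0 : (m2 n)%:R != 0 :> R by rewrite gt_eqF//; near: n; exact: cvgry_gt.
by rewrite (mulrA (l n)%:R) mulrAC mulfK.
Unshelve. all: by end_near. Qed.

Lemma cvg_run_tail_rho (m2 : nat -> nat) (rho : R) (l : nat) : 0 < rho ->
  (m2 n)%:R / n%:R @[n --> \oo] --> rho ->
  run_tail n (m2 n) l @[n --> \oo] --> (1 / (1 + rho)) ^+ l + (rho / (1 + rho)) ^+ l.
Proof.
move=> rho0 m2n.
have nn : n%:R / n%:R @[n --> \oo] --> (1 : R).
  apply: cvg_near_cst; near=> n; rewrite divff// pnatr_eq0 -lt0n.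
  by near: n; exact: nbhs_infty_gt.
have sum : (n + m2 n)%:R / n%:R @[n --> \oo] --> 1 + rho.
  by under eq_fun do rewrite natrD mulrDl; exact: cvgD.
have rho1 : 1 + rho != 0 by rewrite gt_eqF// ltr_wpDr// ltW.
apply: (@cvg_run_tail m2 (fun=> l)); last exact: cvg_ffact_ratio.
exact: (@cvg_ffact_ratio _ (fun n => n)).
Unshelve. all: by end_near. Qed.

Lemma cvg_cdf_T_rv (tie : tie_rule) (m2 : nat -> nat) (a : nat -> R) (F y : R) : 0 <= y ->
  (\forall n \near \oo, 0 < a n) ->
  run_tail n (m2 n) (Num.truncn (y / a n)).+1 @[n --> \oo] --> F ->
  cdf (T_rv tie n (m2 n) (a n)) y @[n --> \oo] --> (1 - F)%:E.
Proof.
move=> y0 a_gt0 tailF.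
have H : \forall n \near \oo, cdf (T_rv tie n (m2 n) (a n)) y =
    (1 - run_tail n (m2 n) (Num.truncn (y / a n)).+1)%:E.
  by apply: filterS a_gt0 => n an; exact: cdf_T_rv.
apply: cvg_EFin; first by apply: filterS H => n ->.
apply: (@near_cvgn _ (fun n => 1 - run_tail n (m2 n) (Num.truncn (y / a n)).+1)).
  by apply: filterS H => n /= ->.
by apply: cvgB => //; exact: cvg_cst.
Qed.

Lemma cvg_cdf_T_rv_lt0 (tie : tie_rule) (m2 : nat -> nat) (a : nat -> R) (y : R) : y < 0 ->
  (forall n, 0 <= a n) ->
  cdf (T_rv tie n (m2 n) (a n)) y @[n --> \oo] --> 0%E.
Proof.
move=> y0 a0; under eq_fun do rewrite cdf_T_rv_lt0//; exact: cvg_cst.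
Qed.

End tails.

(** * The limit theorem *)

Theorem theorem5 (R : realType) (tie : tie_rule) (m2 : nat -> nat)
    (m2_le : forall m1 : nat, (m2 m1 <= m1)%N) :
  [/\ (* m2 >= 1 fixed *)
      forall k : nat, (1 <= k)%N -> (\forall m1 \near \oo, m2 m1 = k) ->
        [/\ cvg_in_distribution (fun m1 => T_rv tie m1 (m2 m1) (m1%:R^-1 : R))
              (beta_prob 1 k),
            forall y : R, 0 < y < 1 ->
              beta_prob 1 k `]-oo, y]%classic = (1 - (1 - y) ^+ k)%:E
          & forall (d : measure_display) (Om : measurableType d)
              (P : probability Om R) (U : 'I_k -> {RV P >-> R}) (i0 : 'I_k),
              mutually_independent U ->
              (forall i, has_law P (U i) (uniform_prob (@ltr01 R))) ->
              has_law P (fun w => \big[Num.min/U i0 w]_(i < k) U i w)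
                (beta_prob 1 k)],
      (* m2 = o(m1), m2 -> oo *)
      (fun m1 => (m2 m1)%:R : R^o) =o_\oo (fun m1 => m1%:R : R^o) ->
      m2 @ \oo --> \oo ->
        cvg_in_distribution
          (fun m1 => T_rv tie m1 (m2 m1) ((m2 m1)%:R / m1%:R : R))
          (exponential_law (@ltr01 R))
        /\ forall y : R, 0 < y -> exponential_prob (1 : R) `]-oo, y]%classic = (1 - expR (- y))%:E
    & (* m2 ~ rho m1 *)
      forall rho : R, 0 < rho <= 1 ->
      (fun m1 => (m2 m1)%:R : R^o) ~_\oo (fun m1 => rho * m1%:R : R^o) ->
        exists Y : probability (measurableTypeR R) R,
          [/\ forall l : nat, (1 <= l)%N ->
                Y [set l%:R] = ((rho + rho ^+ l) / (1 + rho) ^+ l.+1)%:E,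
              cvg_in_distribution (fun m1 => T_rv tie m1 (m2 m1) (1 : R)) Y
            & forall (d : measure_display) (Om : measurableType d)
                (P : probability Om R) (I1 : {RV P >-> bool})
                (G G' : {RV P >-> R}),
                has_law P I1 (bernoulli_prob (1 / (1 + rho))) ->
                geometric_rv (rho / (1 + rho)) G ->
                geometric_rv (1 / (1 + rho)) G' ->
                independent2 I1 G -> independent2 I1 G' ->
                has_law P (fun w => (I1 w)%:R * G w + (1 - (I1 w)%:R) * G' w) Y]].
Proof.
split.
- move=> k k0 m2k; split.
  + move=> y _; rewrite [X in _ --> X](_ : _ = (1 - (1 - clamp01 y) ^+ k)%:E); last first.
      exact: beta1_cdf.
    have [y0|y0] := ltP y 0.
      rewrite /clamp01 (max_idPl _) ?ge_min ?(ltW y0) ?orbT// subr0 expr1n subrr.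
      by apply: cvg_cdf_T_rv_lt0 => // n; rewrite invr_ge0.
    apply: cvg_cdf_T_rv => //; last exact: cvg_run_tail_fixed.
    by near=> n; rewrite invr_gt0 ltr0n; near: n; exact: nbhs_infty_gt.
  + move=> y /andP[y0 y1]; rewrite -[y in RHS](_ : clamp01 y = y).
      exact: beta1_cdf.
    by rewrite /clamp01 (min_idPr (ltW y1)) (max_idPr (ltW y0)).
  + by move=> d Om P U i0; exact: min_uniform_law.
- move=> m2o m2y.
  have m2n : (m2 n)%:R / n%:R @[n --> \oo] --> (0 : R).
    apply: cvg_ratio_of_equiv => e e0.
    move/eqoP : m2o => /(_ e e0); apply: filterS => n.
    by rewrite mul0r subr0 [`|n%:R|]ger0_norm.
  have m2R : (m2 n)%:R @[n --> \oo] --> (+oo : set_system R) by exact/cvgrnyP.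
  split=> [y _|y y0]; last by rewrite exponential_cdf (max_idPr (ltW y0)).
  rewrite [X in _ --> X]exponential_cdf.
  have [y0|y0] := ltP y 0.
    rewrite oppr0 expR0 subrr.
    by apply: cvg_cdf_T_rv_lt0 => // n; rewrite divr_ge0.
  apply: cvg_cdf_T_rv => //; last exact: cvg_run_tail_exp.
  near=> n; rewrite divr_gt0//; last by rewrite ltr0n; near: n; exact: nbhs_infty_gt.
  by near: n; exact: cvgry_gt.
- move=> rho /andP[rho0 rho1] m2rho.
  have m2n : (m2 n)%:R / n%:R @[n --> \oo] --> rho.
    apply: cvg_ratio_of_equiv => e e0.
    move/eqaddoP : m2rho => /(_ (e / rho) (divr_gt0 e0 rho0)); apply: filterS => n.
    by rewrite /= normrM [`|n%:R|]ger0_norm// gtr0_norm// mulrA divfK ?gt_eqF.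
  have [Y [Y1 YN Yge0 Ylt0]] := geometric_mixture_exists rho0.
  have r1 : 1 + rho != 0 by rewrite gt_eqF// ltr_wpDr// ltW.
  exists Y; split.
  + case=> // l _; rewrite Y1 !expr_div_n expr1n; congr EFin.
    have rl : (1 + rho) ^+ l != 0 by rewrite expf_neq0.
    by rewrite !exprS; field; rewrite r1 rl.
  + move=> y _; have [y0|y0] := ltP y 0.
      by rewrite Ylt0//; exact: cvg_cdf_T_rv_lt0.
    rewrite Yge0//; apply: cvg_cdf_T_rv => //; first exact: nearW.
    by under eq_fun do rewrite divr1; exact: cvg_run_tail_rho.
  + move=> d Om P I1 G G' lawI geoG geoG' indG indG'.
    have bE : 1 - 1 / (1 + rho) = rho / (1 + rho) by field.
    have aE : 1 - rho / (1 + rho) = 1 / (1 + rho) by field.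
    apply: (mixture_law _ lawI geoG geoG' indG indG') => //.
      by rewrite divr_ge0 ?addr_ge0 ?(ltW rho0)//= ler_pdivrMr; lra.
    by move=> n; rewrite Y1 bE aE.
Unshelve. all: by end_near. Qed.
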